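(* Let $X=(X_n:n\ge 0)$ be an $S$-valued Markov chain with one-step transition kernel $P$ having a unique stationary distribution, and let $f:S\to\mathbb{R}_+$ be a non-negative measurable function. Suppose there exist a non-empty (measurable) subset $C\subset S$, non-negative measurable functions $v_1,v_2:S\to\mathbb{R}_+$, a probability measure $\varphi$ on $S$, an integer $m\ge 1$, and positive constants $\lambda,b_1,b_2$ such that (i) $(Pv_1)(x)\le v_1(x)-f(x)+b_1\mathbb{I}_C(x)$ for all $x\in S$; (ii) $(Pv_2)(x)\le v_2(x)-1+b_2\mathbb{I}_C(x)$ for all $x\in S$; (iii) $\mathbb{P}_x(X_m\in\cdot)\ge\lambda\varphi(\cdot)$ for all $x\in C$. Let $$\delta_1=\min\left\{\inf_{y\in S}v_1(y)+\frac{2b_1m}{\lambda},\;\varphi v_1+\frac{b_1m}{\lambda}\right\}.$$ Then for every $x\in S$ and every integer $n\ge 0$, $$\mathbb{E}_xf(X_n)\le v_1(x)+\frac{b_1m}{\lambda}+\delta_1 .$$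
   Context: Notation. $(Ph)(x)=\int_S h(y)P(x,dy)$; $\varphi h=\int_S h\,d\varphi$; $\mathbb{I}_C$ is the indicator function of $C$; $\mathbb{P}_x(\cdot)=\mathbb{P}(\cdot\mid X_0=x)$ with expectation $\mathbb{E}_x$. *)

(* Defs.v *)
From HB Require Import structures.
From mathcomp Require Import all_boot all_order all_algebra.
From mathcomp Require Export all_classical all_reals all_analysis.
Set Implicit Arguments.
Unset Strict Implicit.
Unset Printing Implicit Defensive.
Import Order.TTheory GRing.Theory Num.Theory.
Import numFieldNormedType.Exports.
Local Open Scope classical_set_scope.
Local Open Scope ring_scope.
Local Open Scope ereal_scope.

(* (Ph)(x) for a real-valued h; it may be +oo when h >= 0 is not integrable. *)
Definition kernel_op (dS : measure_display) (S : measurableType dS)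
    (R : realType) (P : R.-pker S ~> S) (h : S -> R) (x : S) : \bar R :=
  \int[P x]_y (h y)%:E.

Definition stationary (dS : measure_display) (S : measurableType dS)
    (R : realType) (P : R.-pker S ~> S) (pi : probability S R) : Prop :=
  forall A : set S, measurable A -> \int[pi]_x P x A = pi A.

(* Uniqueness is agreement on measurable sets: a [probability] is a function
   on all subsets, whose values off the sigma-algebra carry no meaning. *)
Definition unique_stationary (dS : measure_display) (S : measurableType dS)
    (R : realType) (P : R.-pker S ~> S) : Prop :=
  exists2 pi : probability S R, stationary P pi &
    forall pi' : probability S R, stationary P pi' ->
      forall A : set S, measurable A -> pi' A = pi A.

(* sigma(X_0, ..., X_n) *)
Definition history (dO dS : measure_display) (Omega : measurableType dO)
    (S : measurableType dS) (X : nat -> Omega -> S) (n : nat) :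
    set (set Omega) :=
  <<s [set E | exists2 k : nat, (k <= n)%N &
         preimage_set_system [set: Omega] (X k) measurable E] >>.

(* The chain on a common sample space with its family of laws
   Pr x = P( . | X_0 = x). The second clause is the conditional identity
   Pr x (X_(n+1) \in A | X_0, ..., X_n) = P (X_n) A integrated over the
   history events.  The first fixes the law of X_0 rather than asking
   X_0 = x almost surely, since singletons of S need not be measurable. *)
Record markov_chain (dO dS : measure_display) (Omega : measurableType dO)
    (S : measurableType dS) (R : realType) (P : R.-pker S ~> S)
    (X : nat -> Omega -> S) (Pr : S -> probability Omega R) : Prop :=
  MarkovChain {
    markov_measurable : forall n : nat, measurable_fun [set: Omega] (X n);
    markov_start : forall (x : S) (A : set S), measurable A ->
      Pr x (X 0%N @^-1` A) = \d_x A;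
    markov_step : forall (x : S) (n : nat) (E : set Omega) (A : set S),
      history X n E -> measurable A ->
      Pr x (E `&` X n.+1 @^-1` A) = \int[Pr x]_(w in E) P (X n w) A
  }.

(* Main.v *)
Require Import Defs.
From HB Require Import structures.
From mathcomp Require Import all_boot all_order all_algebra.
From mathcomp Require Import all_classical all_reals all_analysis.
From mathcomp Require Import measurable_realfun giry ring lra.
Set Implicit Arguments.
Unset Strict Implicit.
Unset Printing Implicit Defensive.
Import Order.TTheory GRing.Theory Num.Theory.
Import numFieldNormedType.Exports.
Local Open Scope classical_set_scope.
Local Open Scope ring_scope.

(* Regeneration. Whenever the chain is in C, the law of its state m steps later
   dominates lambda phi, so with probability lambda it restarts from phi; let G_n
   be the n-step operator of the chain killed at the first such restart. The
   number of visits to C before a restart has mean at most m / lambda, and the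
   first drift condition then gives sum_n G_n f <= v1 + b1 m / lambda. Splitting
   at the first restart,
     P^n f <= G_n f + max_(k < n) phi(P^k f),
   hence phi(P^n f) <= phi(sum_(k <= n) G_k f) by induction on n. The second drift
   condition makes the restarts recur linearly often, and comparing the long-run
   frequencies of f and of b1 times the indicator of C gives
   phi(sum_k G_k f) <= b1 m / lambda. Therefore P^n f <= v1 + 2 b1 m / lambda,
   which is below both alternatives in delta1. *)

(** * Chains as positive operators *)

(* L stands for the real functions that are integrable against all the laws in
   play, so that the kernel P can be treated as an operator g |-> P g on it. *)
Record mean (S : Type) (R : realType) (L : set (S -> R))
    (E : (S -> R) -> R) : Prop := Mean {
  mean_lin : forall a g h, L g -> L h ->
    E (fun x => a * g x + h x) = a * E g + E h;
  mean_le : forall g h, L g -> L h -> (forall x, g x <= h x) -> E g <= E h;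
  mean_cst : forall c, E (fun=> c) = c }.

(** [space_if] is included because the killed operators below are glued from one formula on [C] and
    another off it. *)
Record function_space (S : Type) (R : realType) (C : set S)
    (L : set (S -> R)) : Prop := FunctionSpace {
  space_cst : forall c, L (fun=> c);
  space_lin : forall a g h, L g -> L h -> L (fun x => a * g x + h x);
  space_if : forall g h, L g -> L h ->
    L (fun x => if x \in C then g x else h x) }.

Section means.
Context (S : Type) (R : realType) (C : set S) (L : set (S -> R)).
Hypothesis LC : function_space C L.

Lemma spaceD g h : L g -> L h -> L (fun x => g x + h x).
Proof.
move=> Lg Lh; have := space_lin LC 1 Lg Lh.
by congr L; apply/funext => x; rewrite mul1r.
Qed.

Lemma spaceZ a g : L g -> L (fun x => a * g x).
Proof.
move=> Lg; have := space_lin LC a Lg (space_cst LC 0).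
by congr L; apply/funext => x; rewrite addr0.
Qed.

Lemma space_sum n (g : nat -> S -> R) : (forall i, L (g i)) ->
  L (fun x => \sum_(i < n) g i x).
Proof.
move=> Lg; elim: n => [|n IH].
  have := space_cst LC 0.
  by congr L; apply/funext => x; rewrite big_ord0.
have := spaceD IH (Lg n).
by congr L; apply/funext => x; rewrite big_ord_recr.
Qed.

Lemma space_indic : L (fun x => (x \in C)%:R).
Proof.
have := space_if LC (space_cst LC 1) (space_cst LC 0).
by congr L; apply/funext => x; case: ifP.
Qed.

Variable E : (S -> R) -> R.
Hypothesis ME : mean L E.

Lemma meanD g h : L g -> L h -> E (fun x => g x + h x) = E g + E h.
Proof.
move=> Lg Lh; have := mean_lin ME 1 Lg Lh; rewrite mul1r => <-.
by congr E; apply/funext => x; rewrite mul1r.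
Qed.

Lemma meanZ a g : L g -> E (fun x => a * g x) = a * E g.
Proof.
move=> Lg; have := mean_lin ME a Lg (space_cst LC 0).
rewrite (mean_cst ME) addr0 => <-.
by congr E; apply/funext => x; rewrite addr0.
Qed.

Lemma mean_sum n (g : nat -> S -> R) : (forall i, L (g i)) ->
  E (fun x => \sum_(i < n) g i x) = \sum_(i < n) E (g i).
Proof.
move=> Lg; elim: n => [|n IH].
  rewrite big_ord0 -[RHS](mean_cst ME).
  by congr E; apply/funext => x; rewrite big_ord0.
rewrite big_ord_recr/= -IH -meanD//; last exact: space_sum.
by congr E; apply/funext => x; rewrite big_ord_recr.
Qed.

Lemma mean_ge0 g : L g -> (forall x, 0 <= g x) -> 0 <= E g.
Proof.
move=> Lg g0; rewrite -(mean_cst ME 0) (mean_le ME)//.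
exact: space_cst LC _.
Qed.

Lemma mean_ub c g : L g -> (forall x, g x <= c) -> E g <= c.
Proof.
move=> Lg g0; rewrite -(mean_cst ME c) (mean_le ME)//.
exact: space_cst LC _.
Qed.

End means.

(** * Minorization and the [m]-step law with the restart removed *)

Section regeneration.
Context (S : Type) (R : realType) (C : set S) (L : set (S -> R)).
Hypothesis LC : function_space C L.
Variables (P : (S -> R) -> S -> R) (phi : (S -> R) -> R).
Hypothesis LP : forall g, L g -> L (P g).
Hypothesis MP : forall x, mean L (P ^~ x).
Hypothesis Mphi : mean L phi.
Variables (m : nat) (lambda : R).
Hypothesis m_gt0 : (0 < m)%N.
Hypothesis lambda_gt0 : 0 < lambda.
Hypothesis minorization : forall x, x \in C -> forall g, L g ->
  (forall y, 0 <= g y) -> lambda * phi g <= iter m P g x.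

Lemma space_iter n g : L g -> L (iter n P g).
Proof. by move=> Lg; elim: n => // n IH; exact: LP. Qed.

Lemma mean_iter n x : mean L (fun g => iter n P g x).
Proof.
elim: n x => [|n IH] x; first by split.
have E a g h : L g -> L h -> iter n P (fun y => a * g y + h y) =
    fun y => a * iter n P g y + iter n P h y.
  by move=> Lg Lh; apply/funext => y; rewrite (mean_lin (IH y)).
split=> [a g h Lg Lh|g h Lg Lh gh|c] /=.
- by rewrite E// (mean_lin (MP x))//; exact: space_iter.
- apply: (mean_le (MP x)); [exact: space_iter..|move=> y].
  exact: (mean_le (IH y)).
- rewrite (_ : iter n P _ = fun=> c) ?(mean_cst (MP x))//.
  by apply/funext => y; rewrite (mean_cst (IH y)).
Qed.

(** The part of the [m]-step law that does not restart, left unnormalised with mass [1 - lambda]; at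
    points of [C], [minorization] makes it positive. *)
Definition residual (g : S -> R) (x : S) : R :=
  iter m P g x - lambda * phi g.

Lemma residual_lin a g h x : L g -> L h ->
  residual (fun y => a * g y + h y) x = a * residual g x + residual h x.
Proof.
move=> Lg Lh.
rewrite /residual (mean_lin (mean_iter m x))// (mean_lin Mphi)//; ring.
Qed.

(** By linearity this is positivity at [h - g], which is exactly [minorization]. *)
Lemma residual_le g h x : x \in C -> L g -> L h ->
  (forall y, g y <= h y) -> residual g x <= residual h x.
Proof.
move=> xC Lg Lh gh; rewrite -subr_ge0.
have -> : residual h x - residual g x =
    residual (fun y => -1 * g y + h y) x by rewrite residual_lin//; ring.
rewrite subr_ge0; apply: minorization => //; first exact: space_lin LC _ _ _ _ _.
by move=> y; rewrite mulN1r addrC subr_ge0.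
Qed.

Lemma residual_cst c x : residual (fun=> c) x = (1 - lambda) * c.
Proof.
by rewrite /residual (mean_cst (mean_iter m x)) (mean_cst Mphi) mulrBl mul1r.
Qed.

Lemma residual_ge0 g x : x \in C -> L g -> (forall y, 0 <= g y) ->
  0 <= residual g x.
Proof.
move=> xC Lg g0; rewrite -(mulr0 (1 - lambda)) -(residual_cst 0 x).
by apply: residual_le => //; exact: space_cst LC _.
Qed.

Lemma residual_sum n (g : nat -> S -> R) x : (forall i, L (g i)) ->
  residual (fun y => \sum_(i < n) g i y) x = \sum_(i < n) residual (g i) x.
Proof.
move=> Lg; rewrite /residual (mean_sum LC (mean_iter m x))//.
by rewrite (mean_sum LC Mphi)// mulr_sumr -sumrB.
Qed.

Lemma lambda_le1 x : x \in C -> lambda <= 1.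
Proof.
move=> xC; rewrite -subr_ge0 -[_ - _]mulr1 -(residual_cst 1 x).
by apply: residual_ge0 => //; exact: space_cst LC _.
Qed.

(** * The chain killed at its first restart *)

(** Follows the recursion of [killed] below: time drops by 1 off [C] and by [m] on it, and [m_gt0]
    makes the second drop strict. *)
Lemma block_ind (Q : nat -> S -> Prop) :
  (forall x, x \notin C -> Q 0%N x) ->
  (forall n x, x \notin C -> (forall y, Q n y) -> Q n.+1 x) ->
  (forall n x, x \in C -> (n < m)%N -> Q n x) ->
  (forall n x, x \in C -> (forall y, Q n y) -> Q (m + n)%N x) ->
  forall n x, Q n x.
Proof.
move=> Q0 QS Qlt Qm n; elim/ltn_ind: n => n IH x.
have [xC|xC] := boolP (x \in C).
  have [nm|mn] := ltnP n m; first exact: Qlt.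
  by rewrite -(subnKC mn); apply: Qm => // y; apply: IH;
    rewrite ltn_subrL m_gt0 (leq_trans m_gt0).
by case: n IH => [|n] IH; [exact: Q0|apply: QS => // y; exact: IH].
Qed.

(* The table of [killed i g] for i <= n, which makes the recursion from n to
   n - m structural. *)
Fixpoint killed_history (g : S -> R) (n : nat) : nat -> S -> R :=
  if n is n'.+1 then fun i =>
    if (i <= n')%N then killed_history g n' i else fun x =>
    if x \in C then
      if (n < m)%N then iter n P g x
      else residual (killed_history g n' (n - m)) x
    else P (killed_history g n' n') x
  else fun=> g.

(* E_x [g X_n; no restart up to time n]: off C the chain makes one step; from C
   it makes m steps at once, and lambda phi is removed from the law of X_m. *)
Definition killed (n : nat) (g : S -> R) : S -> R := killed_history g n n.

Lemma killed_historyE g n i : (i <= n)%N -> killed_history g n i = killed i g.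
Proof.
elim: n => [|n IH]; first by rewrite leqn0 => /eqP->.
rewrite leq_eqVlt => /predU1P[->//|]; rewrite ltnS => le_in.
by rewrite /= le_in IH.
Qed.

Lemma killed_step n g x : x \notin C -> killed n.+1 g x = P (killed n g) x.
Proof. by move=> /negbTE xC; rewrite /killed /= ltnn xC. Qed.

Lemma killed_early n g x : x \in C -> (n < m)%N -> killed n g x = iter n P g x.
Proof. by case: n => // n xC nm; rewrite /killed /= ltnn xC nm. Qed.

Lemma killed_block n g x : x \in C ->
  killed (m + n) g x = residual (killed n g) x.
Proof.
move=> xC; rewrite /killed; case E : (m + n)%N => [|k].
  by move: m_gt0 E; case: m.
rewrite [LHS]/= ltnn xC -E ltnNge leq_addr/= addKn killed_historyE//.
by rewrite -ltnS -E -[X in (X < _)%N]add0n ltn_add2r.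
Qed.

(** Each branch is a function on all of [S] lying in [L], so [space_if] glues them; strong induction
    covers the jump from [n.+1] to [n.+1 - m]. *)
Lemma space_killed n g : L g -> L (killed n g).
Proof.
move=> Lg; elim/ltn_ind: n => -[//|n] IH.
have LPn : L (P (killed n g)) by apply/LP/IH.
have [nm|mn] := ltnP n.+1 m.
  have := space_if LC (space_iter n.+1 Lg) LPn; congr L.
  apply/funext => x; case: ifPn => xC; last by rewrite killed_step.
  by rewrite killed_early.
have Ln : L (killed (n.+1 - m) g).
  by apply: IH; rewrite ltn_subrL m_gt0.
have LR : L (residual (killed (n.+1 - m) g)).
  have := spaceD LC (space_iter m Ln)
    (space_cst LC (- (lambda * phi (killed (n.+1 - m) g)))).
  by congr L.
have := space_if LC LR LPn; congr L.
apply/funext => x; case: ifPn => xC; last by rewrite killed_step.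
by rewrite -killed_block// subnKC.
Qed.

Lemma killed_ge0 n g x : L g -> (forall y, 0 <= g y) -> 0 <= killed n g x.
Proof.
move=> Lg g0; have Lk k := space_killed k Lg.
move: n x; apply: block_ind => [//|n x xC IH|n x xC nm|n x xC IH].
- by rewrite killed_step//; apply: (mean_ge0 LC (MP x)).
- by rewrite killed_early//; apply: (mean_ge0 LC (mean_iter n x)).
- by rewrite killed_block// residual_ge0.
Qed.

(** * Expected occupation sums of the full and the killed chain *)

Definition occupation (T : nat -> (S -> R) -> S -> R) (n : nat) (g : S -> R)
  (x : S) : R := \sum_(j < n) T j g x.

Notation iterP := (fun n => iter n P).

Lemma space_occupation_iter n g : L g -> L (occupation iterP n g).
Proof.
by move=> Lg; apply: (space_sum LC n (g := iterP ^~ g)) => i; exact: space_iter.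
Qed.

Lemma space_occupation_killed n g : L g -> L (occupation killed n g).
Proof.
move=> Lg; apply: (space_sum LC n (g := killed ^~ g)) => i.
exact: space_killed.
Qed.

Lemma occupation_iterS n g x : L g ->
  occupation iterP n.+1 g x = g x + P (occupation iterP n g) x.
Proof.
move=> Lg; rewrite /occupation big_ord_recl; congr +%R.
rewrite (mean_sum LC (MP x) n (g := iterP ^~ g))//.
by move=> i; exact: space_iter.
Qed.

Lemma occupation_iterD n g x : L g ->
  occupation iterP (m + n) g x =
  occupation iterP m g x + iter m P (occupation iterP n g) x.
Proof.
move=> Lg; rewrite /occupation big_split_ord; congr +%R.
rewrite (mean_sum LC (mean_iter m x) n (g := iterP ^~ g)); last first.
  by move=> i; exact: space_iter.
by apply: eq_bigr => i _ /=; rewrite iterD.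
Qed.

Lemma occupation_killedS n g x : L g -> x \notin C ->
  occupation killed n.+1 g x = g x + P (occupation killed n g) x.
Proof.
move=> Lg xC; rewrite /occupation big_ord_recl; congr +%R.
rewrite (mean_sum LC (MP x) n (g := killed ^~ g)); last first.
  by move=> i; exact: space_killed.
by apply: eq_bigr => i _; rewrite killed_step.
Qed.

Lemma occupation_killed_early n g x : x \in C -> (n <= m)%N ->
  occupation killed n g x = occupation iterP n g x.
Proof.
move=> xC nm; apply: eq_bigr => i _.
by rewrite killed_early//; exact: leq_trans nm.
Qed.

Lemma occupation_killedD n g x : L g -> x \in C ->
  occupation killed (m + n) g x =
  occupation iterP m g x + residual (occupation killed n g) x.
Proof.
move=> Lg xC; rewrite -(@occupation_killed_early m)// /occupation big_split_ord.
congr +%R; rewrite (@residual_sum n (killed ^~ g)); last first.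
  by move=> i; exact: space_killed.
by apply: eq_bigr => i _; rewrite /= killed_block.
Qed.

Lemma le_occupation_killed n k g x : L g -> (forall y, 0 <= g y) -> (n <= k)%N ->
  occupation killed n g x <= occupation killed k g x.
Proof.
move=> Lg g0 nk; rewrite -(subnKC nk) /occupation big_split_ord lerDl.
by apply: sumr_ge0 => i _; exact: killed_ge0.
Qed.

Let I : S -> R := fun x => (x \in C)%:R.
Let LI : L I. Proof. exact: space_indic LC. Qed.

Lemma occupation_iter_indic n x : occupation iterP n I x <= n%:R.
Proof.
have -> : n%:R = \sum_(i < n) 1 :> R by rewrite sumr_const card_ord.
apply: ler_sum => i _; apply: (mean_ub LC (mean_iter i x)) => // y.
by rewrite lern1 leq_b1.
Qed.

(** A block contributes at most [m] visits and survives with mass [1 - lambda]. A bound [B]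
    therefore propagates once [m + (1 - lambda) B <= B], and [m / lambda] gives equality. *)
Lemma occupation_killed_indic n x : occupation killed n I x <= m%:R / lambda.
Proof.
have B0 : 0 <= m%:R / lambda by rewrite divr_ge0// ltW.
move: n x; apply: block_ind => [x xC|n x xC IH|n x xC nm|n x xC IH].
- by rewrite /occupation big_ord0.
- rewrite occupation_killedS// /I (negbTE xC) add0r.
  by apply: (mean_ub LC (MP x)) => //; exact: space_occupation_killed.
- rewrite occupation_killed_early ?(ltnW nm)//.
  apply: (le_trans (occupation_iter_indic n x)).
  apply: (@le_trans _ _ m%:R); first by rewrite ler_nat ltnW.
  by rewrite ler_pdivlMr// ler_piMr// (lambda_le1 xC).
- rewrite occupation_killedD//.
  have := residual_le xC (space_occupation_killed n LI) (space_cst LC _) IH.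
  rewrite residual_cst; move: (occupation_iter_indic m x).
  have -> : (1 - lambda) * (m%:R / lambda) = m%:R / lambda - m%:R.
    by field; rewrite gt_eqF.
  lra.
Qed.

Lemma drift_iter (v f : S -> R) (b : R) n x : L v -> L f ->
  (forall x, P v x <= v x - f x + b * I x) ->
  iter n P v x + occupation iterP n f x <= v x + b * occupation iterP n I x.
Proof.
move=> Lv Lf drift; elim: n x => [|n IH] x.
  by rewrite /occupation !big_ord0 mulr0 !addr0.
rewrite !occupation_iterS//=.
have LVf := space_occupation_iter n Lf; have LVI := space_occupation_iter n LI.
have := mean_le (MP x) (spaceD LC (space_iter n Lv) LVf)
  (spaceD LC Lv (spaceZ LC b LVI)) IH.
rewrite (meanD (MP x))//; last exact: space_iter.
rewrite (meanD (MP x))//; last exact: spaceZ LC _ _ _.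
rewrite (meanZ LC (MP x))//.
have := drift x; lra.
Qed.

(** Killing preserves the drift bound because a restart only takes away [lambda * phi v >= 0].
    Within a block the chain runs undisturbed for [m] steps, where [drift_iter] applies. *)
Lemma drift_killed (v f : S -> R) (b : R) n x : L v -> L f ->
  (forall x, 0 <= v x) ->
  (forall x, P v x <= v x - f x + b * I x) ->
  occupation killed n f x <= v x + b * occupation killed n I x.
Proof.
move=> Lv Lf v0 drift.
have LVf k := space_occupation_killed k Lf; have LVI k := space_occupation_killed k LI.
have LR k : L (fun y => v y + b * occupation killed k I y).
  by apply: (spaceD LC) => //; exact: (spaceZ LC).
move: n x; apply: block_ind => [x xC|n x xC IH|n x xC nm|n x xC IH].
- by rewrite /occupation !big_ord0 mulr0 addr0.
- rewrite !occupation_killedS//.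
  have := mean_le (MP x) (LVf n) (LR n) IH.
  rewrite (meanD (MP x))//; last exact: spaceZ LC _ _ _.
  rewrite (meanZ LC (MP x))//.
  have := drift x; rewrite /I (negbTE xC); lra.
- rewrite !occupation_killed_early ?(ltnW nm)//.
  apply: le_trans (drift_iter n x Lv Lf drift); rewrite lerDr.
  exact: (mean_ge0 LC (mean_iter n x)).
- rewrite !occupation_killedD//.
  have := residual_le xC (LVf n) (LR n) IH.
  have -> : residual (fun y => v y + b * occupation killed n I y) x =
      b * residual (occupation killed n I) x + residual v x.
    by rewrite -residual_lin//; congr residual; apply/funext => y; rewrite addrC.
  have := drift_iter m x Lv Lf drift.
  have : 0 <= lambda * phi v.
    by rewrite mulr_ge0 ?(ltW lambda_gt0)// (mean_ge0 LC Mphi).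
  rewrite [residual v x]/residual; lra.
Qed.

(** * Comparison of the full chain with the killed one *)

(** Here [s] stands for the full chain and [t] for the killed one. On [C] the full chain keeps an
    extra [lambda * phi (s n) <= lambda * M]; with the [(1 - lambda) * M] carried by the residual
    this is again [M]. Signed [s] and [t] are covered, as [occupation_regeneration] requires. *)
Lemma regeneration_le (s t : nat -> S -> R) (M : R) :
  (forall n, L (s n)) -> (forall n, L (t n)) -> 0 <= M ->
  (forall x, x \notin C -> s 0%N x <= t 0%N x) ->
  (forall n x, x \notin C ->
    s n.+1 x - P (s n) x <= t n.+1 x - P (t n) x) ->
  (forall n x, x \in C -> (n < m)%N -> s n x <= t n x) ->
  (forall n x, x \in C ->
    s (m + n)%N x - iter m P (s n) x <= t (m + n)%N x - residual (t n) x) ->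
  forall n, (forall k, (k < n)%N -> phi (s k) <= M) ->
  forall x, s n x <= t n x + M.
Proof.
move=> Ls Lt M0 st0 stS st_early st_block n ub x.
move: n x ub; apply: block_ind => [x xC _|n x xC IH ub|n x xC nm _|n x xC IH ub].
- by rewrite (le_trans (st0 x xC))// lerDl.
- have IHn y : s n y <= t n y + M by apply: IH => k /ltnW; exact: ub.
  have := mean_le (MP x) (Ls n) (spaceD LC (Lt n) (space_cst LC M)) IHn.
  rewrite (meanD (MP x))//; last exact: space_cst LC _.
  rewrite (mean_cst (MP x)); have := stS n x xC; lra.
- by rewrite (le_trans (st_early _ _ xC nm))// lerDl.
- have IHn y : s n y <= t n y + M.
    by apply: IH => k kn; apply: ub; rewrite (leq_trans kn)// leq_addl.
  have LM := space_cst LC M.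
  have := residual_le xC (Ls n) (spaceD LC (Lt n) LM) IHn.
  have -> : residual (fun y => t n y + M) x =
      residual (t n) x + (1 - lambda) * M.
    rewrite -(residual_cst M x) -[residual (t n) x]mul1r -residual_lin//.
    by congr residual; apply/funext => y; rewrite mul1r.
  have : phi (s n) <= M.
    by apply: ub; rewrite -[X in (X < _)%N]add0n ltn_add2r.
  rewrite -(ler_pM2l lambda_gt0) [residual (s n) x]/residual.
  have := st_block n x xC; lra.
Qed.

(** The increments of both sides agree exactly; a restart with [k] steps left contributes the mean
    [phi (iter k P f) <= M]. *)
Lemma iter_regeneration n f M x : L f -> 0 <= M ->
  (forall k, (k < n)%N -> phi (iter k P f) <= M) ->
  iter n P f x <= killed n f x + M.
Proof.
move=> Lf M0 ub; move: n ub x.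
apply: (@regeneration_le (fun n => iter n P f) (fun n => killed n f)) => //.
- by move=> n; exact: space_iter.
- by move=> n; exact: space_killed.
- by move=> n x xC; rewrite killed_step// !subrr.
- by move=> n x xC nm; rewrite killed_early.
- by move=> n x xC; rewrite killed_block// iterD !subrr.
Qed.

Lemma occupation_regeneration n f c M x : L f -> 0 <= M ->
  (forall k, (k < n)%N ->
    c * phi (occupation iterP k I) - phi (occupation iterP k f) <= M) ->
  c * occupation iterP n I x - occupation iterP n f x <=
  c * occupation killed n I x - occupation killed n f x + M.
Proof.
move=> Lf M0 ub.
pose s k y := c * occupation iterP k I y + -1 * occupation iterP k f y.
pose t k y := c * occupation killed k I y + -1 * occupation killed k f y.
have Ls k : L (s k).
  by apply: (space_lin LC); [|apply: (spaceZ LC)]; exact: space_occupation_iter.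
have Lt k : L (t k).
  by apply: (space_lin LC); [|apply: (spaceZ LC)]; exact: space_occupation_killed.
suff : s n x <= t n x + M by rewrite /s /t !mulN1r.
have phis k : phi (s k) =
    c * phi (occupation iterP k I) - phi (occupation iterP k f).
  rewrite (mean_lin Mphi); [|exact: space_occupation_iter|]; last first.
    by apply: (spaceZ LC); exact: space_occupation_iter.
  by rewrite (meanZ LC Mphi) ?mulN1r//; exact: space_occupation_iter.
have {}ub k : (k < n)%N -> phi (s k) <= M by move=> /ub; rewrite phis.
have EP n' k y : iter n' P (s k) y =
    c * iter n' P (occupation iterP k I) y - iter n' P (occupation iterP k f) y.
  rewrite (mean_lin (mean_iter n' y)); [|exact: space_occupation_iter|]; last first.
    by apply: (spaceZ LC); exact: space_occupation_iter.
  rewrite (meanZ LC (mean_iter n' y)) ?mulN1r//; exact: space_occupation_iter.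
have EPt k y : P (t k) y =
    c * P (occupation killed k I) y - P (occupation killed k f) y.
  rewrite (mean_lin (MP y)); [|exact: space_occupation_killed|]; last first.
    by apply: (spaceZ LC); exact: space_occupation_killed.
  rewrite (meanZ LC (MP y)) ?mulN1r//; exact: space_occupation_killed.
have ER k y : residual (t k) y =
    c * residual (occupation killed k I) y - residual (occupation killed k f) y.
  rewrite residual_lin; [|exact: space_occupation_killed|]; last first.
    by apply: (spaceZ LC); exact: space_occupation_killed.
  congr +%R; rewrite /residual (meanZ LC (mean_iter m y)); last exact: space_occupation_killed.
  rewrite (meanZ LC Mphi); last exact: space_occupation_killed.
  ring.
move: n ub x; apply: regeneration_le => //.
- by move=> x xC; rewrite /s /t /occupation !big_ord0.
- move=> n x xC; have /= -> := EP 1%N; rewrite EPt /s /t.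
  rewrite !occupation_iterS// !occupation_killedS//; lra.
- by move=> n x xC nm; rewrite /s /t !occupation_killed_early ?(ltnW nm).
- move=> n x xC; rewrite EP ER /s /t !occupation_iterD// !occupation_killedD//; lra.
Qed.

(** * Bounds from the two drift conditions *)

Section drift.
Variables (f v1 v2 : S -> R) (b1 b2 : R).
Hypotheses (Lf : L f) (Lv1 : L v1) (Lv2 : L v2).
Hypotheses (f0 : forall x, 0 <= f x) (v10 : forall x, 0 <= v1 x)
  (v20 : forall x, 0 <= v2 x).
Hypotheses (b1_ge0 : 0 <= b1) (b2_ge0 : 0 <= b2).
Hypothesis drift1 : forall x, P v1 x <= v1 x - f x + b1 * I x.
Hypothesis drift2 : forall x, P v2 x <= v2 x - 1 + b2 * I x.

(** For [k < n], the induction hypothesis and positivity bound [phi (iter k P f)] by the killed sum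
    over times below [n], which serves as [M]; the killed term at time [n] completes the sum. *)
Lemma phi_iter_le n : phi (iter n P f) <= phi (occupation killed n.+1 f).
Proof.
have Lk k := space_killed k Lf; have LV k := space_occupation_killed k Lf.
elim/ltn_ind: n => n IH.
have V0 : 0 <= phi (occupation killed n f).
  by apply: (mean_ge0 LC Mphi) => // x; apply: sumr_ge0 => i _; exact: killed_ge0.
have ub k : (k < n)%N -> phi (iter k P f) <= phi (occupation killed n f).
  move=> kn; apply: (le_trans (IH k kn)); apply: (mean_le Mphi) => // x.
  exact: le_occupation_killed.
have -> : phi (occupation killed n.+1 f) =
    phi (fun x => killed n f x + phi (occupation killed n f)).
  rewrite (meanD Mphi)//; last exact: (space_cst LC).
  rewrite (mean_cst Mphi) -(meanD Mphi)//; congr phi.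
  by apply/funext => x; rewrite /occupation big_ord_recr/= addrC.
apply: (mean_le Mphi); first exact: space_iter.
  by apply: (spaceD LC) => //; exact: (space_cst LC).
by move=> x; exact: iter_regeneration.
Qed.

Lemma drift_phi (v g : S -> R) b n : L v -> L g -> (forall x, 0 <= v x) ->
  (forall x, P v x <= v x - g x + b * I x) ->
  phi (occupation iterP n g) <= phi v + b * phi (occupation iterP n I).
Proof.
move=> Lv Lg v0 drift; have LV := space_occupation_iter n LI.
rewrite -(meanZ LC Mphi b LV) -(meanD Mphi)//; last exact: (spaceZ LC).
apply: (mean_le Mphi); first exact: space_occupation_iter.
  by apply: (spaceD LC) => //; exact: (spaceZ LC).
move=> x; apply: le_trans (drift_iter n x Lv Lg drift); rewrite lerDr.
exact: (mean_ge0 LC (mean_iter n x)).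
Qed.

(* Let N_n and F_n be the phi-means of [occupation iterP n] at I and at f. If the
   bound failed at K, then with c := phi (occupation killed K f) * lambda / m > b1
   the quantity c N_n - F_n would be bounded above in n, while the first drift
   condition forces it to grow at least like (c - b1) N_n, which the second drift
   condition makes linear. *)
Lemma phi_occupation_killed_le K :
  phi (occupation killed K f) <= b1 * (m%:R / lambda).
Proof.
have LVI n := space_occupation_iter n LI; have LVf n := space_occupation_iter n Lf.
have LKI n := space_occupation_killed n LI; have LKf n := space_occupation_killed n Lf.
rewrite leNgt; apply/negP => ltF.
set F := phi (occupation killed K f) in ltF.
have mR : 0 < m%:R :> R by rewrite ltr0n.
have ml : 0 < m%:R / lambda by rewrite divr_gt0.
pose c := F / (m%:R / lambda).
have b1c : b1 < c by rewrite ltr_pdivlMr.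
have c0 : 0 <= c := ltW (le_lt_trans b1_ge0 b1c).
have cF : c * (m%:R / lambda) = F by rewrite mulfVK// gt_eqF.
move: c b1c c0 cF => c b1c c0 cF.
have VI0 n : 0 <= phi (occupation iterP n I).
  apply: (mean_ge0 LC Mphi) => // x; apply: sumr_ge0 => i _.
  exact: (mean_ge0 LC (mean_iter i x)).
have Vf0 n : 0 <= phi (occupation iterP n f).
  apply: (mean_ge0 LC Mphi) => // x; apply: sumr_ge0 => i _.
  exact: (mean_ge0 LC (mean_iter i x)).
pose Z n := c * phi (occupation iterP n I) - phi (occupation iterP n f).
have cK0 : 0 <= c * K%:R by rewrite mulr_ge0.
(* For [n <= K] at most [K] visits are counted. For [n > K] what follows a restart is at most
   [c * K] by induction, and the killed part has [phi]-mean at most [c * (m / lambda) - F = 0],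
   since the killed sum of [f] has reached [F] by time [K]. *)
have ZA n : Z n <= c * K%:R.
  elim/ltn_ind: n => n IH; have [nK|Kn] := leqP n K.
    rewrite /Z lerBlDr ler_wpDr// ler_wpM2l//.
    apply: (mean_ub LC Mphi) => // x.
    by rewrite (le_trans (occupation_iter_indic n x))// ler_nat.
  have key x : c * occupation iterP n I x + -1 * occupation iterP n f x <=
      (c * (m%:R / lambda) + c * K%:R) + -1 * occupation killed n f x.
    have := occupation_regeneration x Lf cK0 IH.
    have := ler_wpM2l c0 (occupation_killed_indic n x); lra.
  have := mean_le Mphi (spaceD LC (spaceZ LC c (LVI n)) (spaceZ LC (-1) (LVf n)))
    (spaceD LC (space_cst LC _) (spaceZ LC (-1) (LKf n))) key.
  have LZ a g : L g -> L (fun x => a * g x) by exact: (spaceZ LC).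
  rewrite (meanD Mphi (LZ _ _ (LVI n)) (LZ _ _ (LVf n))).
  rewrite (meanD Mphi (space_cst LC _) (LZ _ _ (LKf n))) (mean_cst Mphi).
  rewrite !(meanZ LC Mphi)// cF.
  have : F <= phi (occupation killed n f).
    by apply: (mean_le Mphi) => // x; rewrite le_occupation_killed// ltnW.
  rewrite /Z; lra.
have V1 n : phi (occupation iterP n (fun=> 1)) = n%:R.
  rewrite (_ : occupation _ _ _ = fun=> n%:R) ?(mean_cst Mphi)//.
  apply/funext => x; transitivity (\sum_(i < n) (1 : R)).
    by apply: eq_bigr => i _; exact: (mean_cst (mean_iter i x) 1).
  by rewrite sumr_const card_ord.
(* With [N] the mean number of visits, [drift1] and [ZA] give [(c - b1) * N <= c * K + phi v1], and
   [drift2] gives [n <= phi v2 + b2 * N]; [B] combines the two. *)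
pose B := (c - b1) * phi v2 + b2 * (c * K%:R + phi v1).
have nB n : (c - b1) * n%:R <= B.
  have d1 := drift_phi n Lv1 Lf v10 drift1.
  have d2 := drift_phi n Lv2 (space_cst LC 1) v20 drift2.
  rewrite V1 in d2.
  have h1 : (c - b1) * phi (occupation iterP n I) <= c * K%:R + phi v1.
    by have := ZA n; rewrite /Z; lra.
  have cb : 0 <= c - b1 by rewrite subr_ge0 ltW.
  have := ler_wpM2l cb d2; have := ler_wpM2l b2_ge0 h1; rewrite /B; lra.
have cb : 0 < c - b1 by rewrite subr_gt0.
have B0 : 0 <= B / (c - b1).
  by apply: divr_ge0; [have := nB 0%N; rewrite mulr0|exact: ltW].
have := archi_boundP B0; rewrite ltr_pdivrMr// mulrC ltNge nB//.
Qed.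

Lemma iter_drift_bound n x :
  iter n P f x <= v1 x + b1 * (m%:R / lambda) + b1 * (m%:R / lambda).
Proof.
have B0 : 0 <= b1 * (m%:R / lambda).
  by rewrite mulr_ge0// divr_ge0 ?ler0n// ltW.
have ub k : (k < n)%N -> phi (iter k P f) <= b1 * (m%:R / lambda).
  by move=> _; exact: le_trans (phi_iter_le k) (phi_occupation_killed_le k.+1).
apply: (le_trans (iter_regeneration x Lf B0 ub)); rewrite lerD2r.
(* A single killed term is at most the whole killed sum, which [drift_killed] controls. *)
apply: (@le_trans _ _ (occupation killed n.+1 f x)).
  rewrite /occupation big_ord_recr/= lerDr.
  by apply: sumr_ge0 => i _; exact: killed_ge0.
apply: (le_trans (drift_killed n.+1 x Lv1 Lf v10 drift1)).
by rewrite lerD2l ler_wpM2l// occupation_killed_indic.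
Qed.

End drift.

End regeneration.

(** * Integration along the chain *)

Section weighted_space.
Context (dS : measure_display) (S : measurableType dS) (R : realType).
Variable W : S -> R.
Hypotheses (mW : measurable_fun [set: S] W) (W1 : forall x, 1 <= W x).

(** The concrete [L]: measurable functions of finite [W]-norm. [W >= 1] puts the constants in it,
    and a measure that integrates [W] integrates all of it. *)
Definition weighted_space : set (S -> R) :=
  [set g : S -> R | measurable_fun [set: S] g /\
           exists c, forall x, `|g x| <= c * W x].

Let W0 x : 0 <= W x. Proof. exact: le_trans (W1 x). Qed.

Lemma weighted_space_weight : weighted_space W.
Proof. by split=> //; exists 1 => x; rewrite mul1r ger0_norm. Qed.

Lemma weighted_function_space (C : set S) : measurable C ->
  function_space C weighted_space.
Proof.
move=> mC; split.
- move=> c; split; first exact: measurable_cst.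
  by exists `|c| => x; rewrite ler_peMr.
- move=> a g h [mg [c gc]] [mh [d hd]]; split.
    by apply: measurable_funD => //; exact: measurable_funM.
  exists (`|a| * c + d) => x; rewrite (le_trans (ler_normD _ _))//.
  by rewrite mulrDl lerD// normrM -mulrA ler_wpM2l.
- move=> g h [mg [c gc]] [mh [d hd]]; split.
    apply: measurable_fun_if => //.
    + apply: (measurable_fun_bool true).
      rewrite setTI (_ : _ @^-1` _ = C)//; apply/seteqP; split => x /=.
        by move/set_mem.
      by move/mem_set.
    + by apply: measurable_funS mg.
    + by apply: measurable_funS mh.
  exists (Num.max c d) => x; case: ifP => _.
    by rewrite (le_trans (gc x))// ler_wpM2r// le_max lexx.
  by rewrite (le_trans (hd x))// ler_wpM2r// le_max lexx orbT.
Qed.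

Lemma weighted_integrable (mu : {measure set S -> \bar R}) g :
  (\int[mu]_y (W y)%:E < +oo)%E -> weighted_space g ->
  mu.-integrable [set: S] (EFin \o g).
Proof.
move=> muW [mg [c gc]].
have iW : mu.-integrable [set: S] (EFin \o W).
  apply/integrableP; split; first exact/measurable_EFinP.
  by under eq_integral do rewrite /= ger0_norm//.
apply: (le_integrable measurableT _ _ (integrableZl measurableT c iW)).
  exact/measurable_EFinP.
by move=> x _ /=; rewrite lee_fin (le_trans (gc x))// ler_norm.
Qed.

Lemma mean_Rintegral (mu : {measure set S -> \bar R}) :
  mu [set: S] = 1%E -> (\int[mu]_y (W y)%:E < +oo)%E ->
  mean weighted_space (fun g => \int[mu]_y g y).
Proof.
move=> mu1 muW; have int g := @weighted_integrable mu g muW.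
split=> [a g h Lg Lh|g h Lg Lh gh|c].
- rewrite RintegralD//; [|exact: integrableZl (int _ Lg)|exact: int].
  by rewrite RintegralZl//; exact: int.
- by apply: le_Rintegral => //; exact: int.
- by rewrite Rintegral_cst// mu1 mulr1.
Qed.

Lemma EFin_Rintegral (mu : {measure set S -> \bar R}) g :
  (\int[mu]_y (W y)%:E < +oo)%E -> weighted_space g ->
  (\int[mu]_y (g y)%:E = (\int[mu]_y g y)%R%:E)%E.
Proof.
move=> muW Lg; rewrite /Rintegral fineK//.
exact: integrable_fin_num (weighted_integrable muW Lg).
Qed.

Variables (P : R.-pker S ~> S) (k : R).
Hypothesis PW : forall x, (\int[P x]_y (W y)%:E <= (k * W x)%:E)%E.

Lemma kernel_weight_fin x : (\int[P x]_y (W y)%:E < +oo)%E.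
Proof. exact: le_lt_trans (PW x) (ltry _). Qed.

Lemma mean_kernel x : mean weighted_space (fun g => \int[P x]_y g y).
Proof. by apply: mean_Rintegral (kernel_weight_fin x); exact: prob_kernel. Qed.

Lemma weighted_space_kernel g : weighted_space g ->
  weighted_space (fun x => \int[P x]_y g y).
Proof.
move=> Lg; have [mg [c gc]] := Lg.
have LC := weighted_function_space measurableT.
have LW := weighted_space_weight.
have LcW : weighted_space (fun x => c * W x + g x) by exact: (space_lin LC).
have m_ge0 h : weighted_space h -> (forall x, 0 <= h x) ->
    measurable_fun [set: S] (fun x => \int[P x]_y h y).
  move=> [mh _] h0; apply: measurableT_comp; first exact: fine_measurable.
  apply: (measurable_fun_integral_kernel _ (k := EFin \o h)) => //.
    exact: measurable_kernel.
  exact/measurable_EFinP.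
(* [m_ge0] handles nonnegative integrands only; since [c * W + g] is nonnegative, a signed [g] is a
   difference of two of them. *)
have E x : \int[P x]_y g y =
    \int[P x]_y (c * W y + g y) - c * \int[P x]_y W y.
  by rewrite (mean_lin (mean_kernel x))// addrAC subrr add0r.
have PWle x : \int[P x]_y W y <= k * W x.
  by rewrite -lee_fin -EFin_Rintegral//; exact: kernel_weight_fin.
split.
  rewrite (_ : (fun x => _) = (fun x => \int[P x]_y (c * W y + g y) -
      c * \int[P x]_y W y)); last by apply/funext.
  apply: measurable_funB; last by apply: measurable_funM => //; exact: m_ge0.
  by apply: m_ge0 => // x; have := gc x; rewrite ler_norml => /andP[]; lra.
exists (c * k) => x.
have c0 : 0 <= c.
  have := le_trans (normr_ge0 _) (gc x).
  by rewrite pmulr_lge0// (lt_le_trans ltr01).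
have LZ : weighted_space (fun x => c * W x) by exact: (spaceZ LC).
apply: (le_trans (le_normr_Rintegral measurableT
  (weighted_integrable (kernel_weight_fin x) Lg))).
apply: (@le_trans _ _ (\int[P x]_y (c * W y))).
  apply: (mean_le (mean_kernel x)) => //; split.
    exact: measurableT_comp.
  by exists c => y; rewrite normr_id.
by rewrite (meanZ LC (mean_kernel x))// -mulrA ler_wpM2l.
Qed.

End weighted_space.

Local Open Scope ereal_scope.

Section kernel_law.
Context (dS : measure_display) (S : measurableType dS) (R : realType).
Variables (P : R.-pker S ~> S) (y : S).

(** A separate name for [P y], to carry the subprobability structure that points of [giry S R]
    require. *)
Definition kernel_law : set S -> \bar R := P y.

HB.instance Definition _ := Measure.copy kernel_law (P y).

Let kernel_law_setT : kernel_law [set: S] <= 1.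
Proof. by rewrite /kernel_law prob_kernel. Qed.

HB.instance Definition _ :=
  Measure_isSubProbability.Build _ _ _ kernel_law kernel_law_setT.

End kernel_law.

(** * Expectations along the chain as iterates of the kernel *)

Section markov_integral.
Context (R : realType) (dO dS : measure_display)
    (Omega : measurableType dO) (S : measurableType dS)
    (P : R.-pker S ~> S) (X : nat -> Omega -> S)
    (Pr : S -> probability Omega R).
Hypothesis hX : markov_chain P X Pr.

Lemma markov_integral0 x (g : S -> \bar R) :
  measurable_fun [set: S] g -> (forall y, 0 <= g y) ->
  \int[Pr x]_w g (X 0 w) = g x.
Proof.
move=> mg g0; have mX := markov_measurable hX 0.
rewrite -(ge0_integral_pushforward mX (Pr x) measurableT mg)//.
rewrite (@eq_measure_integral _ _ _ _ (\d_x)).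
  by rewrite integral_dirac// diracT mul1e.
by move=> A mA _; exact: (markov_start hX).
Qed.

(** The law of [X n.+1] is the Giry bind of [Pr x] along [w |-> P (X n w)]: [markov_step], on the
    full sample space, gives this for events, and [giry_int_bind] passes to integrals. *)
Lemma markov_integralS x n (g : S -> \bar R) :
  measurable_fun [set: S] g -> (forall y, 0 <= g y) ->
  \int[Pr x]_w g (X n.+1 w) = \int[Pr x]_w \int[P (X n w)]_y g y.
Proof.
move=> mg g0.
pose law y : giry S R := kernel_law P y.
have mlaw : measurable_fun [set: Omega] (fun w => law (X n w)).
  apply: measurable_giry_codensity => // B mB.
  exact: measurableT_comp (measurable_kernel P B mB) (markov_measurable hX n).
have mX := markov_measurable hX n.+1.
rewrite -(ge0_integral_pushforward mX (Pr x) measurableT mg)//.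
transitivity (giry_int (giry_bind (Pr x) mlaw) g); last first.
  exact: giry_int_bind.
apply: eq_measure_integral => A mA _.
rewrite /giry_bind/= /giry_join/=.
rewrite giry_int_map//; last exact: measurable_giry_ev.
have XnT : history X n [set: Omega].
  by rewrite -(setD0 setT); apply: sigma_algebraCD; exact: sigma_algebra0.
have := markov_step hX x XnT mA; rewrite setTI.
exact.
Qed.

Section weighted.
Variables (W : S -> R) (k : R).
Hypotheses (mW : measurable_fun [set: S] W) (W1 : forall x, (1 <= W x)%R).
Hypothesis PW : forall x, \int[P x]_y (W y)%:E <= (k * W x)%:E.

(** The last step of the chain is integrated out first, replacing [g] by its image under the kernel;
    hence [g] stays general in the induction. *)
Lemma markov_integral_iter n x (g : S -> R) :
  weighted_space W g -> (forall y, (0 <= g y)%R) ->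
  \int[Pr x]_w (g (X n w))%:E =
  (iter n (fun h z => \int[P z]_y h y)%R g x)%:E.
Proof.
elim: n g => [|n IH] g Lg g0.
  rewrite (markov_integral0 x (g := EFin \o g))//.
  by apply/measurable_EFinP; case: Lg.
rewrite (markov_integralS x n (g := EFin \o g))//; last first.
  by apply/measurable_EFinP; case: Lg.
rewrite iterSr -IH//; last 2 first.
- exact: weighted_space_kernel PW _ Lg.
- by move=> z; exact: Rintegral_ge0.
apply: eq_integral => w _; apply: EFin_Rintegral Lg => //.
exact: kernel_weight_fin PW _.
Qed.

End weighted.

Lemma minorization_integral (phi : probability S R) (lambda : R) m x
    (g : S -> \bar R) :
  (0 <= lambda)%R ->
  (forall A, measurable A -> lambda%:E * phi A <= Pr x (X m @^-1` A)) ->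
  measurable_fun [set: S] g -> (forall y, 0 <= g y) ->
  lambda%:E * \int[phi]_y g y <= \int[Pr x]_w g (X m w).
Proof.
move=> lambda0 minor mg g0; have mX := markov_measurable hX m.
rewrite -(ge0_integral_pushforward mX (Pr x) measurableT mg)//.
rewrite -(@ge0_integral_mscale _ _ _ phi _ measurableT (NngNum lambda0))//.
by apply: ge0_le_measure_integral => // A mA; exact: minor.
Qed.

End markov_integral.

(** * Transfer of the operator bound to the chain *)

Theorem proposition2p3 (R : realType) (dO dS : measure_display)
    (Omega : measurableType dO) (S : measurableType dS)
    (P : R.-pker S ~> S) (X : nat -> Omega -> S)
    (Pr : S -> probability Omega R)
    (hX : markov_chain P X Pr)
    (hP : unique_stationary P)
    (f : S -> R) (mf : measurable_fun [set: S] f)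
    (f0 : forall x, (0 <= f x)%R)
    (C : set S) (mC : measurable C) (C0 : C !=set0)
    (v1 v2 : S -> R)
    (mv1 : measurable_fun [set: S] v1) (v10 : forall x, (0 <= v1 x)%R)
    (mv2 : measurable_fun [set: S] v2) (v20 : forall x, (0 <= v2 x)%R)
    (phi : probability S R) (m : nat) (hm : (1 <= m)%N)
    (lambda b1 b2 : R)
    (lambda0 : (0 < lambda)%R) (b10 : (0 < b1)%R) (b20 : (0 < b2)%R)
    (drift1 : forall x,
       kernel_op P v1 x <= (v1 x - f x + b1 * \1_C x)%:E)
    (drift2 : forall x,
       kernel_op P v2 x <= (v2 x - 1 + b2 * \1_C x)%:E)
    (minor : forall x, C x -> forall A : set S, measurable A ->
       lambda%:E * phi A <= Pr x (X m @^-1` A)) :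
  let delta1 : \bar R :=
    mine (ereal_inf [set (v1 y)%:E | y in [set: S]]
            + (2 * b1 * m%:R / lambda)%:E)
         (\int[phi]_y (v1 y)%:E + (b1 * m%:R / lambda)%:E) in
  forall (x : S) (n : nat),
    'E_(Pr x)[f \o X n] <= (v1 x)%:E + (b1 * m%:R / lambda)%:E + delta1.
Proof.
move=> delta1 x n.
(* Up to a constant factor this weight dominates the constants, [v1], [v2] and [f], and the drift
   conditions bound its image under the kernel by a multiple of itself. *)
pose W y : R := (1 + v1 y + v2 y)%R.
pose T (h : S -> R) (z : S) : R := (\int[P z]_y h y)%R.
have W1 y : (1 <= W y)%R by rewrite /W -addrA lerDl addr_ge0.
have mW : measurable_fun [set: S] W.
  by apply: measurable_funD => //;
    exact: measurable_funD.
have C01 y : (0 <= (\1_C y : R) <= 1)%R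
  by rewrite indicE; case: (_ \in _); rewrite ?lexx ?ler01.
have PW z : \int[P z]_y (W y)%:E <= ((1 + b1 + b2) * W z)%:E.
  rewrite /W; under eq_integral do rewrite EFinD.
  rewrite ge0_integralD//; last 4 first.
  - by move=> y _; rewrite lee_fin addr_ge0.
  - by apply/measurable_EFinP; exact: measurable_funD.
  - by move=> y _; rewrite lee_fin.
  - exact/measurable_EFinP.
  under eq_integral do rewrite EFinD.
  rewrite ge0_integralD//; last 2 first.
  - by move=> y _; rewrite lee_fin.
  - exact/measurable_EFinP.
  rewrite integral_cst// [X in 1 * X]prob_kernel mule1.
  apply: (le_trans (leeD (leeD (lexx _) (drift1 z)) (drift2 z))).
  rewrite -!EFinD lee_fin.
  have /andP[i0 i1] := C01 z.
  have := ler_wpM2l (ltW b10) i1; have := ler_wpM2l (ltW b20) i1.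
  have := ler_wpM2l (ltW b10) (W1 z); have := ler_wpM2l (ltW b20) (W1 z).
  have := f0 z; rewrite /W; lra.
have LC := weighted_function_space W1 mC.
have Lle (v : S -> R) : measurable_fun [set: S] v -> (forall y, (0 <= v y)%R) ->
    (forall y, (v y <= (1 + b1) * W y)%R) -> weighted_space W v.
  by move=> mv v0 vW; split=> //; exists (1 + b1)%R => y; rewrite ger0_norm.
have Wb1 y : (W y <= (1 + b1) * W y)%R.
  by rewrite ler_peMl ?lerDl ?(ltW b10)// (le_trans ler01).
have Lv1 : weighted_space W v1.
  apply: Lle => // y; apply: le_trans (Wb1 y); have := v20 y; rewrite /W; lra.
have Lv2 : weighted_space W v2.
  apply: Lle => // y; apply: le_trans (Wb1 y); have := v10 y; rewrite /W; lra.
(* The integral of [v1] under [P y] is nonnegative, so the first drift condition bounds [f]. *)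
have fle y : (f y <= v1 y + b1)%R.
  have : (0 <= v1 y - f y + b1 * \1_C y)%R.
    by rewrite -lee_fin; apply: le_trans (drift1 y);
    apply: integral_ge0 => t _; rewrite lee_fin.
  have := ler_wpM2l (ltW b10) (andP (C01 y)).2; lra.
have Lf : weighted_space W f.
  apply: Lle => // y; apply: (le_trans (fle y)).
  have := ler_wpM2l (ltW b10) (W1 y); have := v20 y; rewrite /W; lra.
have MP z : mean (weighted_space W) (T ^~ z) := mean_kernel mW W1 PW z.
have LT h : weighted_space W h -> weighted_space W (T h).
  exact: weighted_space_kernel PW _.
have [x0 Cx0] := C0.
(* Minorization at the single point [x0] of [C] bounds [lambda] times this integral by the mean of
   [W] at time [m], which is finite. *)
have phiW : \int[phi]_y (W y)%:E < +oo.
  have mEW : measurable_fun [set: S] (EFin \o W) by exact/measurable_EFinP.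
  have W0 y : 0 <= (W y)%:E by rewrite lee_fin; exact: le_trans (W1 y).
  have := minorization_integral hX (ltW lambda0) (minor _ Cx0) mEW W0.
  rewrite (markov_integral_iter hX mW W1 PW)//; last exact: weighted_space_weight.
  rewrite ltNge leye_eq => le_iter; apply/negP => /eqP E; move: le_iter.
  by rewrite E gt0_muley ?lte_fin// leye_eq.
have Mphi := mean_Rintegral mW W1 (probability_setT phi) phiW.
have driftT (v g : S -> R) b y : weighted_space W v ->
    kernel_op P v y <= (v y - g y + b * \1_C y)%:E ->
    (T v y <= v y - g y + b * (y \in C)%:R)%R.
  move=> Lv; rewrite /kernel_op (EFin_Rintegral mW W1 _ Lv) ?lee_fin ?indicE//.
  exact: kernel_weight_fin PW _.
have key := @iter_drift_bound _ _ _ _ LC _ _ LT MP Mphi m lambda hm lambda0 _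
  f v1 v2 b1 b2 Lf Lv1 Lv2 f0 v10 v20 (ltW b10) (ltW b20)
  (fun y => driftT _ _ _ y Lv1 (drift1 y))
  (fun y => driftT _ (cst 1%R) _ y Lv2 (drift2 y)) n x.
(* The premise still open in [key] is minorization for functions, obtained from the one for
   events. *)
have {}key : (iter n T f x <= v1 x + b1 * (m%:R / lambda) + b1 * (m%:R / lambda))%R.
  apply: key => z /set_mem Cz g Lg g0.
  rewrite -lee_fin EFinM -(EFin_Rintegral mW W1 phiW Lg).
  rewrite -(markov_integral_iter hX mW W1 PW m z Lg)//.
  apply: (minorization_integral hX (g := EFin \o g) (ltW lambda0) (minor _ Cz)).
    by apply/measurable_EFinP; case: Lg.
  by move=> y; rewrite lee_fin.
have B0 : (0 <= b1 * m%:R / lambda)%R.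
  by rewrite divr_ge0 ?(ltW lambda0)// mulr_ge0 ?(ltW b10).
rewrite unlock (markov_integral_iter hX mW W1 PW n x Lf)//.
apply: (@le_trans _ _ ((v1 x)%:E + (b1 * m%:R / lambda)%:E + (b1 * m%:R / lambda)%:E)).
  by rewrite -!EFinD lee_fin -mulrA.
(* As [v1 >= 0], its infimum and its [phi]-mean are nonnegative, so both alternatives in [delta1]
   are at least [b1 * m / lambda]. *)
rewrite leeD2l// le_min; apply/andP; split.
  rewrite -[leLHS]add0e leeD//.
    by apply: le_ereal_inf_tmp => _ [y _ <-]; rewrite lee_fin.
  by rewrite lee_fin -!mulrA mulr2n; lra.
rewrite -[leLHS]add0e leeD2r//; apply: integral_ge0 => y _.
by rewrite lee_fin.
Qed.
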